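(* Let $\theta=(k_r)$ be a lacunary sequence with $\liminf_r q_r>1$. Let $A$ be an $N_\theta$-ward compact subset of $\mathbb{R}$ and let $f:A\to\mathbb{R}$ be an $N_\theta$-ward continuous function on $A$. Then $f$ is uniformly continuous on $A$.
   Context: A lacunary sequence is an increasing sequence of integers $\theta=(k_r)_{r\ge 0}$ with $k_0=0$ and $h_r:=k_r-k_{r-1}\to\infty$. Put $I_r=(k_{r-1},k_r]$ (integers in this interval) and $q_r=k_r/k_{r-1}$ (for $r\ge 2$). A real sequence $(\alpha_k)_{k\ge1}$ is $N_\theta$-quasi-Cauchy if $\lim_{r\to\infty}\frac1{h_r}\sum_{k\in I_r}|\alpha_{k+1}-\alpha_k|=0$. A set $A\subset\mathbb{R}$ is $N_\theta$-ward compact if every sequence of points in $A$ has an $N_\theta$-quasi-Cauchy subsequence (re-indexed by $1,2,3,\dots$). A function $f:A\to\mathbb{R}$ is $N_\theta$-ward continuous on $A$ if $(f(\alpha_k))$ is $N_\theta$-quasi-Cauchy whenever $(\alpha_k)$ is an $N_\theta$-quasi-Cauchy sequence of points in $A$. *)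

(* Defs.v *)
From mathcomp Require Import all_boot all_order all_algebra.
From mathcomp Require Import all_classical all_reals all_analysis.
Import Order.TTheory GRing.Theory Num.Theory.
Import numFieldNormedType.Exports.
Set Implicit Arguments.
Unset Strict Implicit.
Unset Printing Implicit Defensive.

Local Open Scope classical_set_scope.
Local Open Scope ring_scope.

(* Real sequences are indexed by k >= 1: they are functions on nat whose value
   at 0 is never used. Likewise the block index r starts at 1 for lac_h and
   Ntheta_mean and at 2 for lac_q; the values at smaller indices are junk (lac_q
   at 1 divides by theta 0 = 0), which does not affect limits and inferior
   limits in r. *)

Definition lac_h (theta : nat -> nat) (r : nat) : nat :=
  (theta r - theta r.-1)%N.

(* As theta increases from 0, its integer terms are naturals. *)
Definition lacunary (theta : nat -> nat) : Prop :=
  [/\ theta 0%N = 0%N, increasing_seq theta & lac_h theta @ \oo --> \oo].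

Definition lac_q (R : realType) (theta : nat -> nat) (r : nat) : R :=
  (theta r)%:R / (theta r.-1)%:R.

Definition Ntheta_mean (R : realType) (theta : nat -> nat) (alpha : R^nat)
    (r : nat) : R :=
  (lac_h theta r)%:R^-1 *
    \sum_((theta r.-1).+1 <= k < (theta r).+1) `|alpha k.+1 - alpha k|.

Definition Ntheta_quasi_Cauchy (R : realType) (theta : nat -> nat)
    (alpha : R^nat) : Prop :=
  Ntheta_mean theta alpha @ \oo --> (0 : R).

Definition seq_in (R : realType) (A : set R) (alpha : R^nat) : Prop :=
  forall k, (0 < k)%N -> A (alpha k).

(* A strictly increasing n : nat -> nat satisfies n k >= k, so that the terms
   of alpha \o n at indices k >= 1 are terms of alpha at indices >= 1. *)
Definition Ntheta_ward_compact (R : realType) (theta : nat -> nat)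
    (A : set R) : Prop :=
  forall alpha : R^nat, seq_in A alpha ->
  exists n : nat -> nat,
    increasing_seq n /\ Ntheta_quasi_Cauchy theta (alpha \o n).

(* A function on A is represented by a total function of which only the values
   on A are used. *)
Definition Ntheta_ward_continuous (R : realType) (theta : nat -> nat)
    (A : set R) (f : R -> R) : Prop :=
  forall alpha : R^nat, seq_in A alpha ->
  Ntheta_quasi_Cauchy theta alpha -> Ntheta_quasi_Cauchy theta (f \o alpha).

(* The uniformity of subspace A restricts that of R on A and is discrete
   outside A. *)
Definition unif_continuous_on (R : realType) (A : set R) (f : R -> R) : Prop :=
  unif_continuous (f : subspace A -> R).

(* Main.v *)
(* An N_theta-ward compact set is bounded, so if uniform continuity failed,
   Bolzano-Weierstrass would give x_n, y_n in A with a common limit and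
   |f(x_n) - f(y_n)| >= e. Any sequence with terms z_n in {x_n, y_n} converges,
   hence is N_theta-quasi-Cauchy, and the choice can be made successively so that
   |f(z_(n+1)) - f(z_n)| >= e / 2 for all n; then every block mean of the
   sequence f(z_n) is at least e / 2. *)

Require Import Defs.
From mathcomp Require Import all_boot all_order all_algebra.
From mathcomp Require Import all_classical all_reals all_analysis.
From mathcomp Require Import lra.
Import Order.TTheory GRing.Theory Num.Theory.
Import numFieldNormedType.Exports.

Local Open Scope classical_set_scope.
Local Open Scope ring_scope.

Lemma increasing_seq_ge_id (u : nat -> nat) (n : nat) :
  increasing_seq u -> (n <= u n)%N.
Proof.
move=> /increasing_seqP u_lt; elim: n => // n IHn.
exact: leq_ltn_trans IHn (u_lt n).
Qed.

Lemma Ntheta_mean_ge (R : realType) (theta : nat -> nat) (alpha : R^nat)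
    (c : R) (r : nat) : (theta r.-1 < theta r)%N ->
  (forall k, (theta r.-1 < k)%N -> c <= `|alpha k.+1 - alpha k|) ->
  c <= Ntheta_mean theta alpha r.
Proof.
rewrite -subn_gt0 => h_gt0 alpha_ge.
rewrite /Ntheta_mean mulrC ler_pdivlMr ?ltr0n// mulr_natr /lac_h -subSS.
rewrite -(sumr_const_nat (theta r).+1 (theta r.-1).+1).
by apply: ler_sum_nat => k /andP[+ _]; exact: alpha_ge.
Qed.

Lemma Ntheta_mean_le (R : realType) (theta : nat -> nat) (alpha : R^nat)
    (c : R) (r : nat) : (theta r.-1 < theta r)%N ->
  (forall k, (theta r.-1 < k)%N -> `|alpha k.+1 - alpha k| <= c) ->
  Ntheta_mean theta alpha r <= c.
Proof.
rewrite -subn_gt0 => h_gt0 alpha_le.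
rewrite /Ntheta_mean mulrC ler_pdivrMr ?ltr0n// mulr_natr /lac_h -subSS.
rewrite -(sumr_const_nat (theta r).+1 (theta r.-1).+1).
by apply: ler_sum_nat => k /andP[+ _]; exact: alpha_le.
Qed.

(** Were all jumps at least [c], every block mean would be too. Both the boundedness of [A] and the
    theorem end in a contradiction with this. *)
Lemma Ntheta_quasi_Cauchy_small_jump (R : realType) (theta : nat -> nat)
    (alpha : R^nat) (c : R) : increasing_seq theta -> 0 < c ->
  Ntheta_quasi_Cauchy theta alpha -> exists k, `|alpha k.+1 - alpha k| < c.
Proof.
move=> /increasing_seqP theta_lt c_gt0 /cvgr_lt/(_ c c_gt0)[N _ mean_lt].
apply: contrapT => no_small; have := mean_lt N.+1 (leqnSn N).
apply/negP; rewrite -leNgt.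
apply: Ntheta_mean_ge => [|k _]; first exact: theta_lt.
by rewrite leNgt; apply/negP => lt_c; apply: no_small; exists k.
Qed.

(** A block mean is at most the largest jump in its block, and the blocks move off to infinity. *)
Lemma cvg_Ntheta_quasi_Cauchy (R : realType) (theta : nat -> nat)
    (alpha : R^nat) (l : R) : increasing_seq theta ->
  alpha @ \oo --> l -> Ntheta_quasi_Cauchy theta alpha.
Proof.
move=> theta_inc alpha_l.
have jump0 : (fun k => alpha k.+1 - alpha k) @ \oo --> (0 : R).
  by rewrite -(subrr l); apply: cvgB => //; rewrite (cvg_shiftS alpha).
apply/cvgr0Pnorm_le => e e_gt0.
have /cvgr0Pnorm_le/(_ e e_gt0)[N _ jump_le] := jump0.
(* Block [r.+1] only involves indices [k > theta r >= r], so [N < r.+1] puts all of them past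
   [N]. *)
exists N.+1 => // -[//|r] /= Nr.
have theta_lt : (theta r < theta r.+1)%N by move/increasing_seqP: theta_inc; exact.
rewrite ger0_norm; last by apply: Ntheta_mean_ge.
apply: Ntheta_mean_le => // k theta_k; apply: jump_le => /=.
apply: leq_trans (ltnW theta_k).
apply: leq_trans (increasing_seq_ge_id _ r theta_inc).
exact: Nr.
Qed.

(* In an unbounded set, choose each term to exceed its predecessor by 1 in
   absolute value: all the jumps of any subsequence are then at least 1. *)
Lemma Ntheta_ward_compact_bounded (R : realType) (theta : nat -> nat)
    (A : set R) : increasing_seq theta -> Ntheta_ward_compact theta A ->
  exists M, forall x, A x -> `|x| <= M.
Proof.
move=> theta_inc A_compact; apply: contrapT => A_unbounded.
have /choice[g gP] (w : R) : exists x, A x /\ `|w| + 1 <= `|x|.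
  apply: contrapT => no_x; apply: A_unbounded; exists (`|w| + 1) => x Ax.
  by rewrite leNgt; apply/negP => /ltW wx; apply: no_x; exists x.
(* The start 0 may lie outside [A]: [gP] holds for every real [w], and [seq_in] ignores index 0. *)
pose alpha n := iter n g 0.
have alphaA : seq_in A alpha by case=> // k _; have [] := gP (alpha k).
have [n [/increasing_seqP n_inc alpha_qC]] := A_compact alpha alphaA.
have [k] := Ntheta_quasi_Cauchy_small_jump _ _ _ _ theta_inc ltr01 alpha_qC.
apply/negP; rewrite -leNgt /=.
have alpha_norm : nondecreasing_seq (fun i => `|alpha i|).
  apply/nondecreasing_seqP => i; have [_] := gP (alpha i).
  by apply: le_trans; rewrite lerDl.
(* By the reverse triangle inequality it is enough to compare norms. The norm gains 1 from [n k] to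
   [(n k).+1] and does not drop from there to [n k.+1]. *)
rewrite (le_trans _ (lerB_dist _ _))// lerBrDl.
have [_] := gP (alpha (n k)) => /le_trans; apply.
exact: (alpha_norm (n k).+1 (n k.+1) (n_inc k)).
Qed.

Lemma unif_continuous_onP (R : realType) (A : set R) (f : R -> R) :
  (forall e, 0 < e -> exists2 d, 0 < d &
    forall x y, A x -> A y -> `|x - y| < d -> `|f x - f y| < e) ->
  unif_continuous_on A f.
Proof.
move=> fP U; rewrite -entourage_ballE => -[e /= e_gt0 eU].
have [d d_gt0 dP] := fP e e_gt0.
exists [set xy | ball xy.1 d xy.2]; first by rewrite -entourage_ballE; exists d.
(* A pair in a subspace entourage is either diagonal or has both components in [A]. *)
move=> [x y] /= [->|[Ax [Ay xy]]]; apply: eU => /=; first exact: ballxx.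
exact: dP.
Qed.

Theorem theorem15 (R : realType) (theta : nat -> nat) (A : set R) (f : R -> R)
    (theta_lac : lacunary theta)
    (liminf_q : (1 < limn_einf (fun r => (lac_q R theta r)%:E))%E)
    (A_compact : Ntheta_ward_compact theta A)
    (f_cont : Ntheta_ward_continuous theta A f) :
  unif_continuous_on A f.
Proof.
have [_ theta_inc _] := theta_lac.
apply: unif_continuous_onP => e e_gt0; apply: contrapT => not_unif.
have /choice[xy xyP] (n : nat) : exists xy : R * R,
    [/\ A xy.1, A xy.2, `|xy.1 - xy.2| < n.+1%:R^-1 & e <= `|f xy.1 - f xy.2|].
  apply: contrapT => no_xy; apply: not_unif; exists n.+1%:R^-1 => // x y Ax Ay xy.
  by rewrite ltNge; apply/negP => fxy; apply: no_xy; exists (x, y).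
have [M AM] := Ntheta_ward_compact_bounded _ _ _ theta_inc A_compact.
have [phi phi_inc /cvg_ex[/= p x_p]] : exists2 phi : nat -> nat,
    increasing_seq phi & cvgn ((fun n => (xy n).1) \o phi).
  apply: bolzano_weierstrass; exists M; split; first exact: num_real.
  by move=> M' /ltW MM' n _ /=; apply: le_trans MM'; apply: AM; have [] := xyP n.
pose x n := (xy (phi n)).1; pose y n := (xy (phi n)).2.
(* Since [f (x n)] and [f (y n)] are [e] apart, one of them is at least [e / 2]
   away from the value at the previous term. *)
pose pick n w := if e / 2 <= `|f (x n) - f w| then x n else y n.
pose z := fix z n := if n is n'.+1 then pick n (z n') else x 0%N.
have zxy n : z n = x n \/ z n = y n.
  by case: n => [|n] /=; [left|rewrite /pick; case: ifP; [left|right]].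
have zA : seq_in A z.
  by move=> n _; have [? ? _ _] := xyP (phi n); have [->|->] := zxy n.
have z_p : z @ \oo --> p.
  (* The correction [z n - x n] is 0 or [y n - x n], hence at most [1 / (n + 1)] in norm because
     [n <= phi n]. *)
  have -> : z = (fun n => x n + (z n - x n)).
    by apply/funext => n; rewrite addrC subrK.
  rewrite -[p]addr0; apply: cvgD => //.
  apply: norm_cvg0; apply: (squeeze_cvgr _ (cvg_cst 0) cvg_harmonic).
  apply: nearW => n; rewrite normr_ge0 /=.
  have [->|->] := zxy n; first by rewrite subrr normr0 invr_ge0.
  have [_ _ /ltW + _] := xyP (phi n); rewrite distrC => /le_trans; apply.
  by rewrite lef_pV2 ?posrE// ler_nat ltnS; exact: increasing_seq_ge_id.
have e2_gt0 : 0 < e / 2 by rewrite divr_gt0.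
have fz_qC := f_cont z zA (cvg_Ntheta_quasi_Cauchy _ _ _ _ theta_inc z_p).
have [k] := Ntheta_quasi_Cauchy_small_jump _ _ _ _ theta_inc e2_gt0 fz_qC.
apply/negP; rewrite -leNgt /= /pick; case: ifPn => //; rewrite -ltNge => xz.
have [_ _ _] := xyP (phi k.+1); rewrite -/(x _) -/(y _) => fxy.
have := le_trans fxy (ler_distD (f (z k)) _ _).
rewrite [`|f (z k) - _|]distrC; lra.
Qed.
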